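(* $\operatorname{asdim}\mathbb{Q}=1$, where $\mathbb{Q}$ is the additive group of rational numbers, regarded as a countable group equipped with a left invariant proper metric.
   Context: Asymptotic dimension of a metric space: a family $\mathcal{U}$ of subsets of a metric space $(X,d)$ is $R$-bounded if $\sup\{\operatorname{diam} U \mid U\in\mathcal{U}\}\le R$, and it is $D$-disjoint if $d(x,y)>D$ whenever $x\in U$, $y\in V$, $U,V\in\mathcal{U}$ and $U\ne V$. One says $\operatorname{asdim} X\le n$ if for every $D>0$ there are a number $R$ and $n+1$ families $\mathcal{U}_0,\dots,\mathcal{U}_n$ of subsets of $X$, each $D$-disjoint and $R$-bounded, such that $\bigcup_i\mathcal{U}_i$ is a cover of $X$; $\operatorname{asdim} X$ is the least such $n$. Asymptotic dimension of a countable group: a metric is proper if closed bounded sets are compact. Every countable group $G$ admits a left invariant proper metric (for such a metric every bounded set is finite), any two such metrics are coarsely equivalent, and asymptotic dimension is invariant under coarse equivalence. $\operatorname{asdim} G$ denotes the asymptotic dimension of $(G,d)$ for any left invariant proper metric $d$ on $G$; it does not depend on the choice of $d$. In particular, the metric on $\mathbb{Q}$ here is not the Euclidean metric, which is not proper on $\mathbb{Q}$. *)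

(* Defs.v *)
From HB Require Import structures.
From mathcomp Require Import all_boot all_order all_algebra.
From mathcomp Require Import all_classical all_reals all_analysis.

Set Implicit Arguments.
Unset Strict Implicit.
Unset Printing Implicit Defensive.

Import Order.TTheory GRing.Theory Num.Theory.

Local Open Scope classical_set_scope.
Local Open Scope ring_scope.

Section metric_notions.
Context {R : realType} {X : metricType R}.

(* Supremum in the extended reals, so diam set0 = -oo. *)
Definition diam (U : set X) : \bar R :=
  ereal_sup [set z | exists x y, [/\ U x, U y & z = (mdist x y)%:E]].

Definition bounded_family (r : R) (F : set (set X)) : Prop :=
  (ereal_sup [set diam U | U in F] <= r%:E)%E.

Definition disjoint_family (D : R) (F : set (set X)) : Prop :=
  forall U V, F U -> F V -> U <> V ->
  forall x y, U x -> V y -> D < mdist x y.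

End metric_notions.

Section asymptotic_dimension.
Context {R : realType} (X : metricType R).

Definition asdim_le (n : nat) : Prop :=
  forall D : R, 0 < D ->
  exists (r : R) (F : 'I_n.+1 -> set (set X)),
    [/\ forall i, disjoint_family D (F i),
        forall i, bounded_family r (F i)
      & cover (\bigcup_i F i) id = [set: X]].

Definition is_asdim (n : nat) : Prop :=
  asdim_le n /\ forall m, asdim_le m -> (n <= m)%N.

Definition proper_metric : Prop :=
  forall A : set X, closed A -> (diam A < +oo)%E -> compact A.

End asymptotic_dimension.

Record metric (R : realType) (T : Type) := Metric {
  dist :> T -> T -> R ;
  dist_refl : forall x, dist x x = 0 ;
  dist_separated : forall x y, dist x y = 0 -> x = y ;
  dist_sym : forall x y, dist x y = dist y x ;
  dist_triangle : forall y x z, dist x z <= dist x y + dist y z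
}.

(* The type T carrying the metric d and the topology it induces; the alias
   keeps them apart from any other structure T may have. *)
Definition metric_space (R : realType) (T : choiceType) (d : metric R T) : Type :=
  T.

HB.instance Definition _ (R : realType) (T : choiceType) (d : metric R T) :=
  Choice.on (metric_space d).
HB.instance Definition _ (R : realType) (T : choiceType) (d : metric R T) :=
  isMetric.Build R (metric_space d) (dist_refl d) (@dist_separated _ _ d)
    (dist_sym d) (dist_triangle d).

Definition left_invariant (R : realType) (G : zmodType) (d : metric R G) : Prop :=
  forall g x y, d (g + x) (g + y) = d x y.

Definition left_invariant_proper (R : realType) (G : zmodType)
    (d : metric R G) : Prop :=
  left_invariant d /\ proper_metric (metric_space d).

(* The asymptotic dimension of a countable additive group is n: left invariant
   proper metrics exist, and for each of them the dimension is n. *)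
Definition group_asdim (R : realType) (G : countZmodType) (n : nat) : Prop :=
  (exists d : metric R G, left_invariant_proper d) /\
  (forall d : metric R G, left_invariant_proper d ->
     is_asdim (metric_space d) n).

(* Main.v *)
Require Import Defs.
From mathcomp Require Import all_boot all_order all_algebra.
From mathcomp Require Import all_classical all_reals all_analysis.
From mathcomp Require Import ring lra zify.

(** A left invariant proper metric [d] on [rat] has finite balls.  Indeed a
    countable space with a compact ball has an isolated point, by the argument
    of Baire's theorem ([countable_compact_isolated]); translating it, every point is
    isolated, and a compact set of isolated points is finite
    ([proper_ball_finite]).  Both bounds on the dimension use only this
    finiteness.

    Dimension at most 1 ([asdim_rat_le1]).  Given a scale [D], the finitely
    many rationals of length at most [D] have a common denominator [m] and are
    smaller than some [b] in ordinary absolute value.  Cut each coset of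
    (1/m)Z into pieces by the multiples of [b], the [k]-th piece going from
    [k * b] included to [(k + 1) * b] excluded.  Two points at
    [d]-distance at most [D] lie in the same coset, and in equal or adjacent
    pieces of it.  So the pieces with [k] even are [D]-disjoint, as are those
    with [k] odd.  The difference of two points of one piece is an element of
    (1/m)Z of absolute value less than [b]; there are finitely many of these,
    hence a common bound on the diameters.

    Dimension not 0 ([asdim_rat_nle0]).  If one family is disjoint at a scale
    larger than [d 0 1], the chain 0, 1, 2, ... never leaves the member that
    contains 0, so all the natural numbers lie in one ball, contradicting its
    finiteness.

    Such a metric exists: the length |q| + ln (denominator of q) is
    subadditive, because the denominator of a sum divides the product of the
    denominators, and only finitely many rationals have bounded size and
    bounded denominator ([height_metric_finite]). *)

Set Implicit Arguments.
Unset Strict Implicit.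
Unset Printing Implicit Defensive.

Import Order.TTheory GRing.Theory Num.Theory.

Local Open Scope classical_set_scope.
Local Open Scope ring_scope.

(** * Metric spaces *)

Definition cball (R : realType) (X : metricType R) (x : X) (r : R) : set X :=
  [set y | mdist x y <= r].

Lemma closed_cball (R : realType) (X : metricType R) (x : X) (r : R) :
  closed (cball x r).
Proof.
move=> y cly; rewrite /cball /=; apply/ler_addgt0Pr => e e0.
have [z [/= xz]] := cly _ (nbhsx_ballx y e e0).
rewrite ballEmdist /= => yz.
apply: (le_trans (metric_triangle _ z _)); rewrite lerD// metric_sym.
exact: ltW.
Qed.

(** The inductive step of the nested balls construction: when [x] is not
    isolated, any prescribed point [y], even [x] itself, can be avoided by a
    smaller ball. *)
Lemma cball_avoid (R : realType) (X : metricType R) (x y : X) (r : R) :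
  0 < r ->
  (forall e, 0 < e -> exists2 z, z != x & mdist x z < e) ->
  exists x' r', [/\ 0 < r', cball x' r' `<=` cball x r & ~ cball x' r' y].
Proof.
move=> r0 lim.
have [->{y}|yx] := eqVneq y x.
  have [z zx xz] := lim _ r0.
  have d0 : 0 < mdist x z by rewrite mdist_gt0 eq_sym.
  exists z, (Num.min (r - mdist x z) (mdist x z / 2)); split.
  - by rewrite lt_min subr_gt0 xz divr_gt0.
  - move=> w; rewrite /cball /= le_min => /andP[h _].
    by have := metric_triangle x z w; lra.
  - by rewrite /cball /= le_min metric_sym => /andP[_]; lra.
have d0 : 0 < mdist x y by rewrite mdist_gt0 eq_sym.
exists x, (Num.min r (mdist x y / 2)); split.
- by rewrite lt_min r0 divr_gt0.
- by move=> w; rewrite /cball /= le_min => /andP[].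
- by rewrite /cball /= le_min => /andP[_]; lra.
Qed.

(** If no point were isolated, nested closed balls could be chosen so that the
    n-th one misses the n-th point of the space.  By compactness they have a
    common point, and that point has no place in the enumeration. *)
Lemma countable_compact_isolated (R : realType) (X : metricType R) (x0 : X)
    (r0 : R) :
  countable [set: X] -> 0 < r0 -> compact (cball x0 r0) ->
  exists (x : X) (e : R), 0 < e /\ forall y, mdist x y < e -> y = x.
Proof.
move=> /countable_injP[p pinj] r0_gt0 cK; apply: contrapT => niso.
have lim (x : X) (e : R) : 0 < e -> exists2 z, z != x & mdist x z < e.
  move=> e0; apply: contrapT => nz; apply: niso; exists x, e; split=> // y xy.
  by apply/eqP; apply: contrapT => yx; apply: nz; exists y => //; exact/negP.
(* When no point has number [n] the ball is kept unchanged.  The hypothesis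
   0 < b.2 makes the step total, so that it can be iterated before the radii
   are known to be positive. *)
pose step (n : nat) (b b' : X * R) := 0 < b.2 ->
  [/\ 0 < b'.2, cball b'.1 b'.2 `<=` cball b.1 b.2 &
      forall y, p y = n -> ~ cball b'.1 b'.2 y].
have ex_step (nb : nat * (X * R)) : {b' | step nb.1 nb.2 b'}.
  case: nb => n [x r]; apply: cid; rewrite /step /=.
  have [r_gt0|nr] := pselect (0 < r); last by exists (x, r) => /nr.
  have [[y py]|ny] := pselect (exists y, p y = n).
    have [x' [r' [? ? nin]]] := cball_avoid y r_gt0 (@lim x).
    exists (x', r') => _; split=> //= z pz.
    by rewrite (pinj z y) ?in_setE// pz py.
  by exists (x, r) => _; split=> //= y py; case: ny; exists y.
pose b := fix b n := if n is m.+1 then sval (ex_step (m, b m)) else (x0, r0).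
have b_step n : step n (b n) (b n.+1) by exact: (svalP (ex_step (n, b n))).
have b_gt0 n : 0 < (b n).2 by elim: n => //= n IH; case: (b_step n IH).
pose B n := cball (b n).1 (b n).2.
have BS n m : (n <= m)%N -> B m `<=` B n.
  elim: m => [|m IH]; first by rewrite leqn0 => /eqP ->.
  rewrite leq_eqVlt ltnS => /predU1P[->//|/IH]; apply: subset_trans.
  by case: (b_step m (b_gt0 m)).
have cB n : B n (b n).1 by rewrite /B /cball /= mdistxx ltW.
have evB n : ((fun k => (b k).1) @ \oo) (B n).
  by exists n => // m /= nm; apply: (BS _ _ nm); exact: cB.
have [z [_ clz]] := cK _ _ (evB 0%N).
have Bz n : B n z.
  apply: (@closed_cball _ _ (b n).1 (b n).2) => U Uz.
  exact: clz (evB n) Uz.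
have [_ _ /(_ z erefl)] := b_step (p z) (b_gt0 _); apply.
exact: (Bz (p z).+1).
Qed.

(** On an infinite [A] the sets that contain all but finitely many points of [A]
    form a proper filter; as it contains the complement of each singleton, it
    has no cluster point when singletons are open. *)
Lemma discrete_compact_finite (X : topologicalType) (A : set X) :
  (forall x : X, open [set x]) -> compact A -> finite_set A.
Proof.
move=> op1 cA; apply: contrapT => infA.
pose F : set_system X := [set B | finite_set (A `\` B)].
have FF : ProperFilter F.
  apply: Build_ProperFilter; first by rewrite /F /= setD0.
  split; first by rewrite /F /= setDT; exact: finite_set0.
    by move=> P Q FP FQ; rewrite /F /= setDIr finite_setU.
  move=> P Q PQ; apply: sub_finite_set; exact: setDS.
have FA : F A by rewrite /F /= setDv; exact: finite_set0.
have [p [_ clp]] := cA _ _ FA.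
have FNp : F (~` [set p]) by rewrite /F /= setDE setCK; exact: finite_setIr.
have [q [/= nqp]] := clp _ _ FNp (open_nbhs_nbhs (conj (op1 p) erefl)).
exact: nqp.
Qed.

Lemma bounded_familyP (R : realType) (X : metricType R) (r : R)
    (F : set (set X)) : bounded_family r F <->
  forall U x y, F U -> U x -> U y -> mdist x y <= r.
Proof.
split=> [bF U x y FU Ux Uy|bF].
  rewrite -lee_fin (le_trans _ bF)//.
  apply: (@le_trans _ _ (diam U)); apply: ereal_sup_ubound.
    by exists x, y.
  by exists U.
apply: ge_ereal_sup => _ [U FU <-]; apply: ge_ereal_sup => _ [x [y [Ux Uy ->]]].
by rewrite lee_fin (bF U).
Qed.

(** * Left invariant proper metrics on countable groups *)

Section proper_invariant.
Variables (R : realType) (G : countZmodType) (d : metric R G).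
Hypothesis dinv : left_invariant d.

Lemma dist_ge0 (x y : G) : 0 <= d x y.
Proof. exact: (@mdist_ge0 R (metric_space d)). Qed.

Lemma dist_sub x y : d x y = d 0 (y - x).
Proof. by rewrite -(dinv x 0) addr0 addrC subrK. Qed.

(** One isolated point suffices, since translations are isometries. *)
Lemma isolated_open (x : metric_space d) e : 0 < e ->
  (forall y, d x y < e -> y = x) -> forall y : metric_space d, open [set y].
Proof.
move=> e0 iso y; rewrite openE => _ ->; apply/nbhs_ballP.
exists e => //= z; rewrite ballEmdist /= => yz.
have : d x (z - y + x) < e by rewrite dist_sub addrK -dist_sub.
move=> /iso /(congr1 (fun w => w - x + y)).
by rewrite addrK subrK subrr add0r.
Qed.

Lemma diam_cball (x : metric_space d) r : (diam (cball x r) <= (r + r)%:E)%E.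
Proof.
apply: ge_ereal_sup => _ [y [z [xy xz ->]]]; rewrite lee_fin.
apply: (le_trans (metric_triangle _ x _)); rewrite lerD//.
by rewrite metric_sym.
Qed.

Lemma proper_ball_finite : proper_metric (metric_space d) ->
  forall r, finite_set [set x : G | d 0 x <= r].
Proof.
move=> dp r.
have cK s : compact (cball (0 : metric_space d) s).
  apply: dp; first exact: closed_cball.
  by rewrite (le_lt_trans (diam_cball _ _)) ?ltry.
have cG : countable [set: metric_space d] := countableP (_ : set G).
have [x [e [e0 iso]]] := countable_compact_isolated cG ltr01 (cK 1).
exact: discrete_compact_finite (isolated_open e0 iso) (cK r).
Qed.

Lemma finite_ball_proper :
  (forall r, finite_set [set x : G | d 0 x <= r]) ->
  proper_metric (metric_space d).
Proof.
move=> fin A _ dA; apply: finite_compact.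
have [->|/set0P[x Ax]] := eqVneq A set0; first exact: finite_set0.
have dle (y : metric_space d) : A y -> ((d x y)%:E <= diam A)%E.
  by move=> Ay; apply: ereal_sup_ubound; exists x, y.
have dfin : diam A \is a fin_num.
  by rewrite fin_numElt dA (lt_le_trans _ (dle _ Ax)) ?ltNyr.
apply: (@sub_finite_set _ _
  ((fun z => z + x) @` [set z | d 0 z <= fine (diam A)])).
  move=> y Ay; exists (y - x); last by rewrite subrK.
  by rewrite /= -dist_sub -lee_fin fineK// dle.
exact: finite_image.
Qed.

(** In dimension 0 the member of a cover, disjoint at a scale larger than
    [d 0 g], that contains 0 must contain each successive multiple of [g]. *)
Lemma asdim0_multiples_bounded (g : G) : asdim_le (metric_space d) 0 ->
  exists r, forall n, d 0 (g *+ n) <= r.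
Proof.
have D0 : 0 < d 0 g + 1 by rewrite ltr_wpDl// dist_ge0.
move=> /(_ _ D0)[r [F [disj bnd cov]]].
have cover0 (x : metric_space d) : exists2 U, F ord0 U & U x.
  have : cover (\bigcup_i F i) id x by rewrite cov.
  by case=> U [i _]; rewrite (ord1 i); exists U.
have [U FU U0] := cover0 0.
exists r => n; move/bounded_familyP: (bnd ord0) => bnd0.
apply: (bnd0 _ 0 (g *+ n) FU U0).
elim: n => [|n IH]; first by rewrite mulr0n.
have [V FV Vn] := cover0 (g *+ n.+1).
suff -> : U = V by [].
apply: contrapT => UV; have := disj ord0 _ _ FU FV UV _ _ IH Vn.
rewrite -[mdist _ _]/(d _ _) (dist_sub (g *+ n)) mulrSr addrAC subrr add0r.
lra.
Qed.

End proper_invariant.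

(** * Rational numbers of bounded size and denominator *)

Lemma finite_set_ubound (R : realDomainType) (T : eqType) (A : set T)
    (f : T -> R) :
  finite_set A -> exists r, forall x, A x -> f x <= r.
Proof.
move=> /finite_seqP[s ->]; elim: s => [|a s [r IH]]; first by exists 0.
exists (Num.max (f a) r) => x /=; rewrite inE le_max.
by case/predU1P => [->|/IH ->]; rewrite ?lexx ?orbT.
Qed.

Lemma finite_set_int (k : nat) : finite_set [set z : int | `|z| <= k%:Z].
Proof.
apply: (@sub_finite_set _ _ ((fun i : nat => i%:Z - k%:Z) @` `I_(k + k).+1)).
  by move=> z /= zk; exists (absz (z + k%:Z)) => /=; lia.
exact/finite_image/finite_II.
Qed.

Lemma denq_le (m : int) (q : rat) :
  0 < m -> m%:~R * q \is a Num.int -> denq q <= m.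
Proof.
move=> m0 /intrP[k mq].
have e : m * numq q = k * denq q.
  by apply/eqP; rewrite -(eqr_int rat) !intrM numqE mulrA mq.
have : (denq q %| m * numq q)%Z by rewrite e dvdz_mull.
rewrite Gauss_dvdzl; last by rewrite /coprimez gcdzC; exact: coprime_num_den.
rewrite dvdzE => /dvdn_leq; rewrite absz_gt0 gt_eqF// => /(_ isT).
by have := denq_gt0 q; lia.
Qed.

Lemma denqD (x y : rat) : denq (x + y) <= denq x * denq y.
Proof.
apply: denq_le; first by rewrite mulr_gt0.
have -> : (denq x * denq y)%:~R * (x + y) =
    (numq x * denq y + denq x * numq y)%:~R.
  by rewrite intrD !intrM !numqE; ring.
exact: intr_int.
Qed.

Lemma finite_set_height (n : nat) :
  finite_set [set q : rat | `|q| <= n%:R /\ denq q <= n%:Z].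
Proof.
pose I k := [set z : int | `|z| <= k%:Z].
apply: (@sub_finite_set _ _
  ((fun p : int * int => p.1%:~R / p.2%:~R) @` (I (n * n)%N `*` I n))).
  move=> q [/= qn dn]; exists (numq q, denq q); last exact: divq_num_den.
  split; rewrite /I /= ?normr_denq//.
  rewrite -(ler_int rat) intr_norm numqE normrM PoszM intrM ler_pM//.
  by rewrite -intr_norm normr_denq ler_int.
by apply: finite_image; apply: finite_setX; exact: finite_set_int.
Qed.

Lemma common_denominator (A : set rat) : finite_set A ->
  exists2 m : int, 0 < m & forall q, A q -> m%:~R * q \is a Num.int.
Proof.
move=> /finite_seqP[s ->]; elim: s => [|a s [m m0 IH]]; first by exists 1.
exists (denq a * m); first by rewrite mulr_gt0.
move=> q /=; rewrite inE intrM => /predU1P[->|/IH mq].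
  by rewrite mulrAC [_ * a]mulrC -numqE -intrM intr_int.
by rewrite -mulrA rpredM ?intr_int.
Qed.

(** Two numbers at distance less than 1 have equal or consecutive integer
    parts, which a common parity forces to be equal. *)
Lemma floor_near (x y : rat) : `|y - x| < 1 ->
  odd `|Num.floor x| = odd `|Num.floor y| -> Num.floor x = Num.floor y.
Proof.
rewrite ltr_norml => /andP[h1 h2].
have /andP[a1 a2] := floor_itv x; have /andP[b1 b2] := floor_itv y.
move: a2 b2; rewrite !intrD => a2 b2.
have : Num.floor x < Num.floor y + 2 by rewrite -(ltr_int rat) intrD; lra.
have : Num.floor y < Num.floor x + 2 by rewrite -(ltr_int rat) intrD; lra.
lia.
Qed.

(** * The dimension of the rational numbers *)

(** The cosets of (1/m)Z are cut at the multiples of [b], and the pieces are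
    sorted into two families by the parity of their position in the coset. *)
Lemma asdim_rat_le1 (R : realType) (d : metric R rat) :
  left_invariant d -> (forall r, finite_set [set x : rat | d 0 x <= r]) ->
  asdim_le (metric_space d) 1.
Proof.
move=> dinv fin D D0.
have [m m0 mint] := common_denominator (fin D).
have [b b0 ltb] : exists2 b : rat, 0 < b & forall q, d 0 q <= D -> `|q| < b.
  have [c cub] := finite_set_ubound (fun q : rat => `|q|) (fin D).
  exists (Num.max c 0 + 1); first by rewrite ltr_wpDl// le_max lexx orbT.
  by move=> q /cub qc; rewrite (le_lt_trans qc)// ltr_pwDr// le_max lexx.
pose cell (x : rat) : set (metric_space d) :=
  [set y : rat | m%:~R * (y - x) \is a Num.int /\
    Num.floor (y / b) = Num.floor (x / b)].
have cellxx x : cell x x by rewrite /cell /= subrr mulr0.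
have cell_sub (x y u v : rat) : cell x u -> cell y v ->
    m%:~R * (v - u) \is a Num.int ->
    Num.floor (u / b) = Num.floor (v / b) -> cell x `<=` cell y.
  move=> [xu fu] [yv fv] uv fuv z [xz fz]; split; last by rewrite fz -fu fuv fv.
  have -> : m%:~R * (z - y) =
    m%:~R * (z - x) - m%:~R * (u - x) - m%:~R * (v - u) + m%:~R * (v - y).
    by ring.
  by rewrite rpredD// rpredB// rpredB.
have close (x u v : rat) : cell x u -> cell x v ->
    m%:~R * (v - u) \is a Num.int /\ `|v - u| < b.
  move=> [xu fu] [xv fv]; split.
    have -> : m%:~R * (v - u) = m%:~R * (v - x) - m%:~R * (u - x) by ring.
    by rewrite rpredB.
  have /andP[] := floor_itv (u / b); have /andP[] := floor_itv (v / b).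
  rewrite fu fv intrD !ler_pdivlMr// !ltr_pdivrMr// mulrDl mul1r.
  by rewrite ltr_norml; lra.
(* A difference of two points of a piece has denominator at most [m] and
   absolute value at most [b]. *)
have [r rub] := finite_set_ubound (d 0)
  (finite_set_height (maxn (absz m) (absz (Num.ceil b)))).
exists r, (fun i =>
  cell @` [set x | odd (absz (Num.floor (x / b))) = i :> nat]).
split.
- move=> i _ _ [x xi <-] [y yi <-] neq u v xu yv; rewrite ltNge; apply/negP.
  rewrite -[mdist _ _]/(d _ _) dist_sub// => duv; apply: neq.
  have mvu := mint _ duv.
  have fuv : Num.floor (u / b) = Num.floor (v / b).
    apply: floor_near.
      by rewrite -mulrBl normrM normfV (gtr0_norm b0) ltr_pdivrMr// mul1r ltb.
    have [[_ fu] [_ fv]] := (xu, yv).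
    by rewrite fu fv; move: xi yi => /= <-; do 2 case: odd.
  apply/seteqP; split; first exact: cell_sub xu yv _ _.
  by apply: cell_sub yv xu _ _ => //; rewrite -opprB mulrN rpredN.
- move=> i; apply/bounded_familyP => _ u v [x _ <-] xu xv.
  rewrite -[mdist _ _]/(d _ _) dist_sub//; apply: rub.
  have [mvu vub] := close _ _ _ xu xv; split.
    rewrite (le_trans (ltW vub))// (le_trans (ceil_ge b))//.
    by rewrite pmulrn ler_int; move: (Num.ceil b) => k; lia.
  by rewrite (le_trans (denq_le m0 mvu))//; lia.
- apply/seteqP; split=> // x _; exists (cell x) => //.
  by exists (inord (odd (absz (Num.floor (x / b))))) => //; exists x => //=;
    rewrite inordK//; case: odd.
Qed.

Lemma asdim_rat_nle0 (R : realType) (d : metric R rat) :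
  left_invariant d -> (forall r, finite_set [set x : rat | d 0 x <= r]) ->
  ~ asdim_le (metric_space d) 0.
Proof.
move=> dinv fin /(asdim0_multiples_bounded dinv 1)[r rub].
have [c cub] := finite_set_ubound (fun q : rat => q) (fin r).
have := cub _ (rub (Num.bound `|c|)); rewrite leNgt; case/negP.
exact: (le_lt_trans (ler_norm _) (archi_boundP (normr_ge0 _))).
Qed.

(** * A left invariant proper metric on the rational numbers *)

Section height_metric.
Variable R : realType.

(** The logarithm turns the submultiplicativity of denominators into
    subadditivity; the archimedean term is there to control numerators. *)
Definition height (q : rat) : R := `|ratr q| + ln (denq q)%:~R.

Lemma denqR_ge1 q : 1 <= (denq q)%:~R :> R.
Proof. by rewrite (ler_int R 1) -gtz0_ge1 denq_gt0. Qed.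

Lemma height0 : height 0 = 0.
Proof. by rewrite /height raddf0 normr0 add0r (denq_int 0) ln1. Qed.

Lemma heightN q : height (- q) = height q.
Proof. by rewrite /height denqN raddfN normrN. Qed.

Lemma height_eq0 q : height q = 0 -> q = 0.
Proof.
move=> /eqP; rewrite paddr_eq0// ?ln_ge0 ?denqR_ge1// => /andP[+ _].
by rewrite normr_eq0 fmorph_eq0 => /eqP.
Qed.

Lemma heightD x y : height (x + y) <= height x + height y.
Proof.
rewrite /height rmorphD /= addrACA lerD ?ler_normD//.
have dpos z : 0 < (denq z)%:~R :> R by rewrite ltr0z denq_gt0.
by rewrite -lnM ?posrE// ler_ln ?posrE ?mulr_gt0// -intrM ler_int denqD.
Qed.

Definition height_dist (x y : rat) : R := height (y - x).

Lemma height_dist_refl x : height_dist x x = 0.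
Proof. by rewrite /height_dist subrr height0. Qed.

Lemma height_dist_separated x y : height_dist x y = 0 -> x = y.
Proof. by move=> /height_eq0/eqP; rewrite subr_eq0 => /eqP. Qed.

Lemma height_dist_sym x y : height_dist x y = height_dist y x.
Proof. by rewrite /height_dist -heightN opprB. Qed.

Lemma height_dist_triangle y x z :
  height_dist x z <= height_dist x y + height_dist y z.
Proof.
rewrite /height_dist; have -> : z - x = y - x + (z - y) by ring.
exact: heightD.
Qed.

Definition height_metric : metric R rat :=
  Defs.Metric height_dist_refl height_dist_separated height_dist_sym
    height_dist_triangle.

Lemma height_metric_inv : left_invariant height_metric.
Proof.
move=> g x y; rewrite /= /height_dist; congr height.
by rewrite opprD addrACA subrr add0r.
Qed.

Lemma height_metric_finite r :
  finite_set [set x : rat | height_metric 0 x <= r].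
Proof.
pose n := Num.bound (expR r).
apply: (sub_finite_set _ (finite_set_height n)) => q /=.
rewrite /height_dist subr0 /height => hr.
have ln0 : 0 <= ln (denq q)%:~R :> R by rewrite ln_ge0 ?denqR_ge1.
have nr : 0 <= `|ratr q| :> R by [].
have er : expR r <= n%:R :> R.
  exact/ltW/archi_boundP/expR_ge0.
split.
  rewrite -(ler_rat R) ratr_norm ratr_nat (le_trans _ er)//.
  rewrite (@le_trans _ _ r)//; first by lra.
  by rewrite (le_trans _ (expR_ge1Dx r))// lerDr.
rewrite -(ler_int R) (le_trans _ er)//.
rewrite -[leLHS]lnK ?posrE ?ltr0z ?denq_gt0// ler_expR; lra.
Qed.

End height_metric.

(** * The theorem *)

Theorem theorem4 (R : realType) : group_asdim R rat 1.
Proof.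
split.
  exists (height_metric R); split; first exact: height_metric_inv.
  exact: finite_ball_proper (@height_metric_inv R) (@height_metric_finite R).
move=> d [dinv dprop].
have fin := proper_ball_finite dinv dprop.
split; first exact: asdim_rat_le1.
by case=> // /(asdim_rat_nle0 dinv fin).
Qed.
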